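(* Consider the noiseless simulated annealing chain $(a_t)_{t\ge 0}$ on the arm set $\mathcal{A}$ described in the context, with arbitrary initial distribution and cooling schedule $T_t=\frac{\gamma}{\log(t+1)}$. Let $\Delta=\max_{i\in\mathcal{A}\setminus\{a^*\}}(\mu_i-\mu_{a^*})$ and suppose $\gamma>\tau L\ge\gamma^*$. Then there is a constant $m_0<\infty$ such that for all $n\ge m_0$ the regret $R_n$ satisfies $$R_n\le \frac{2\Delta\exp\Big(\frac{R^\tau}{\tau^{\frac{\tau L}{\gamma}}(1-\frac{\tau L}{\gamma})}\big(\frac{m_0}{\tau}+1\big)^{1-\frac{\tau L}{\gamma}}\Big)}{\Big(\frac{R^\tau}{\tau(1-\frac{\tau L}{\gamma})}\Big)^{\big\lfloor\frac{1}{1-\frac{\tau L}{\gamma}}\big\rfloor}}\;\Gamma\Bigg(1+\Bigg\lceil\frac{1}{1-\frac{\tau L}{\gamma}}\Bigg\rceil\Bigg)+\sum_{a\in\mathcal{A}\setminus\{a^*\}}\frac{4\Delta\,g(a)}{g(a^* )\big(1-\frac{\mu_a-\mu_{a^*}}{\gamma}\big)}(n+1)^{1-\frac{\mu_a-\mu_{a^*}}{\gamma}},$$ where $\Gamma$ is the gamma function. Consequently $$R_n=\mathcal{O}\Big(\sum_{a\in\mathcal{A}\setminus\{a^*\}}n^{1-\frac{\mu_a-\mu_{a^*}}{\gamma}}\Big).$$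
   Context: Setting. $\mathcal{A}$ is a finite set of $k\ge 2$ arms (states) with a bounded real cost $\mu:\mathcal{A}\to\mathbb{R}$, $a\mapsto\mu_a$, having a unique minimizer $a^*$. The arms are the nodes of a connected graph; $\mathcal{N}(a)\subset\mathcal{A}\setminus\{a\}$ is the set of neighbours of $a$, with $a\in\mathcal{N}(a')$ if and only if $a'\in\mathcal{N}(a)$. Weights satisfy $g(a,a')=g(a',a)=1$ whenever $a,a'$ are neighbours, and $g(a)=\sum_{a'\in\mathcal{N}(a)}g(a,a')$. Noiseless simulated annealing. $(a_t)_{t\ge 0}$ is the time-inhomogeneous Markov chain on $\mathcal{A}$ whose transition matrix $P(t)$ from time $t$ to $t+1$ is, for $x\ne y$, $$P_{x,y}(t)=\begin{cases}0,& y\notin\mathcal{N}(x),\\ \frac{g(x,y)}{g(x)}\exp\Big(-\frac{(\mu_y-\mu_x)^+}{T_t}\Big),& y\in\mathcal{N}(x),\end{cases}\qquad P_{x,x}(t)=1-\sum_{y\in\mathcal{N}(x)}P_{x,y}(t),$$ where $(z)^+=\max(0,z)$ and at $T_0=\infty$ the exponential is read as $1$. Write $\mathbf{P}(m,n)=\prod_{t=m}^{n-1}P(t)$. Regret. $R_n=\sum_{i\in\mathcal{A}}(\mu_i-\mu_{a^*})\sum_{t=1}^n\mathbb{P}(a_t=i)$. Constants. $L=\max_{i\in\mathcal{A}}\max_{j\in\mathcal{N}(i)}|\mu_j-\mu_i|$ and $R=\min_{i\in\mathcal{A}}\min_{j\in\mathcal{N}(i)}\frac{g(i,j)}{g(i)}$.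 $\tau$ is the smallest positive integer such that $\max_{s}\min_{i}\mathbf{P}_{is}(m-\tau,m)>0$ for all $m>\tau$ (the zero pattern of $P(t)$ is the same for all $t\ge 1$, so this does not depend on $m$). Critical depth $\gamma^*$. For a path $p=(i_0,\dots,i_n)$ in the graph (each $i_{m+1}\in\mathcal{N}(i_m)$) let $\mathrm{Elev}(p)=\max_{0\le m\le n}\mu_{i_m}$ and $e(p)=\mathrm{Elev}(p)-\mu_{i_0}-\mu_{i_n}$. For a selection $\mathcal{P}$ of paths (one path from $i$ to $j$ for each pair $i,j\in\mathcal{A}$) let $\mathcal{E}(\mathcal{P})=\sup_{p\in\mathcal{P}}e(p)$, and let $\mathbf{e}$ be the minimum of $\mathcal{E}(\mathcal{P})$ over all selections $\mathcal{P}$. Then $\gamma^*=\mathbf{e}+\mu_{a^*}$. (Equivalently, $\gamma^*$ is the smallest number such that from every $i\in\mathcal{A}$ there is a path to $a^*$ along which $\mu$ never exceeds $\mu_i+\gamma^*$.) *)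

(* Defs.v *)
From HB Require Import structures.
From mathcomp Require Import all_boot all_order all_algebra.
From mathcomp Require Import all_classical all_reals all_analysis.

Set Implicit Arguments.
Unset Strict Implicit.
Unset Printing Implicit Defensive.

Import Order.TTheory GRing.Theory Num.Theory.
Import numFieldNormedType.Exports.

Local Open Scope classical_set_scope.
Local Open Scope ring_scope.

(* Euler's integral; meaningful for x > 0. *)
Definition Gamma (R : realType) (x : R) : R :=
  \int[@lebesgue_measure R]_(t in `]0, +oo[) (t `^ (x - 1) * expR (- t)).

Section Graph.
Context {R : realType} {k : nat}.
Variables (adj : rel 'I_k) (mu : 'I_k -> R) (g : 'I_k -> 'I_k -> R).

Definition node_weight (x : 'I_k) : R := \sum_(y | adj x y) g x y.

(* The maximands are nonnegative, so the default value 0 is harmless. *)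
Definition max_step : R :=
  \big[Num.max/0]_(i < k) \big[Num.max/0]_(j < k | adj i j) `|mu j - mu i|.

(* The quotients are at most 1, so the default value 1 is harmless. *)
Definition min_ratio : R :=
  \big[Num.min/1]_(i < k) \big[Num.min/1]_(j < k | adj i j)
    (g i j / node_weight i).

Definition max_gap (astar : 'I_k) : R :=
  \big[Num.max/0]_(i < k | i != astar) (mu i - mu astar).

(* The path (i, p_0, ..., p_(n-1)) is represented, as in the library, by its
   origin i and the sequence p; p = [::] is the path of length 0. *)
Definition elevation (i : 'I_k) (p : seq 'I_k) : R :=
  \big[Num.max/mu i]_(x <- p) mu x.

Definition excess (i : 'I_k) (p : seq 'I_k) : R :=
  elevation i p - mu i - mu (last i p).

Definition path_selection (S : 'I_k -> 'I_k -> seq 'I_k) : Prop :=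
  forall i j, path adj i (S i j) /\ last i (S i j) = j.

Definition selection_excess (S : 'I_k -> 'I_k -> seq 'I_k) : R :=
  sup [set excess ij.1 (S ij.1 ij.2) | ij in [set: 'I_k * 'I_k]].

(* In a connected graph this infimum is a minimum: selections exist and
   selection_excess takes finitely many values. *)
Definition min_excess : R :=
  inf [set selection_excess S | S in [set S | path_selection S]].

Definition critical_depth (astar : 'I_k) : R := min_excess + mu astar.

(* At infinite temperature every move is accepted. *)
Definition acceptance (T : \bar R) (x y : 'I_k) : R :=
  if T is r%:E then expR (- (Num.max 0 (mu y - mu x) / r)) else 1.

Definition annealing_move (T : \bar R) (x y : 'I_k) : R :=
  if adj x y then g x y / node_weight x * acceptance T x y else 0.

Definition annealing_matrix (T : nat -> \bar R) (t : nat) : 'M[R]_k :=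
  \matrix_(x, y)
    if x == y then 1 - \sum_(z | adj x z) annealing_move (T t) x z
    else annealing_move (T t) x y.

End Graph.

Definition log_cooling (R : realType) (gamma : R) (t : nat) : \bar R :=
  if t is 0 then +oo%E else (gamma / ln (t%:R + 1))%:E.

Section Chain.
Context {R : realType} {k : nat}.
Variable P : nat -> 'M[R]_k.

Definition transition (m n : nat) : 'M[R]_k := \prod_(m <= t < n) P t.

(* max_s min_i of the entries (i, s) over tau steps is positive; these entries
   are probabilities, so the default values 0 and 1 are harmless. *)
Definition contracting_lag (tau : nat) : Prop :=
  forall m : nat, (tau < m)%N ->
    0 < \big[Num.max/0]_(s < k) \big[Num.min/1]_(i < k)
          transition (m - tau) m i s.

Definition contraction_time : nat :=
  xget 0 [set tau | [/\ (0 < tau)%N, contracting_lag tau &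
    forall u, (0 < u)%N -> contracting_lag u -> (tau <= u)%N]].

(* Time-inhomogeneous Markov chain on a probability space with one-step
   transition matrices P t and unrestricted initial law.  The Markov property
   is written without division, so that it also covers null histories. *)
Definition markov_chain (d : measure_display) (Omega : measurableType d)
    (Pr : probability Omega R) (a : nat -> Omega -> 'I_k) : Prop :=
  (forall t i, measurable [set w | a t w = i]) /\
  (forall t (x : nat -> 'I_k),
     Pr [set w | forall s, (s <= t.+1)%N -> a s w = x s] =
     (Pr [set w | forall s, (s <= t)%N -> a s w = x s]
      * (P t (x t) (x t.+1))%:E)%E).

End Chain.

Definition regret (R : realType) (k : nat) (mu : 'I_k -> R) (astar : 'I_k)
    (d : measure_display) (Omega : measurableType d)
    (Pr : probability Omega R) (a : nat -> Omega -> 'I_k) (n : nat) : R :=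
  \sum_(i < k) (mu i - mu astar) *
    \sum_(1 <= t < n.+1) fine (Pr [set w | a t w = i]).

(* Main.v *)
Require Import Defs.
From HB Require Import structures.
From mathcomp Require Import all_boot all_order all_algebra.
From mathcomp Require Import all_classical all_reals all_analysis.
From mathcomp Require Import ring lra zify.
Import Order.TTheory GRing.Theory Num.Theory.
Import numFieldNormedType.Exports.
Local Open Scope classical_set_scope.
Local Open Scope ring_scope.

(** Write [nu_t] for the law of the chain at time [t] and [P_t] for its
transition matrix.  The unnormalised Gibbs weights
[gibbs t x = deg x * (t + 1) ^ (- (mu x - mu a* ) / gamma)] satisfy detailed
balance with respect to [P_t], hence are invariant under [P_t]
([gibbs_stationary]).  They decrease in time and are constant at [a*], so that
their total mass [Z_t] decreases to [deg a*], and the excess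
[y_t = Z_t - deg a*] is the sum of the weights of the suboptimal states.

The signed vector [v_t = Z_t nu_t - gibbs t] has total sum zero.  As
[gibbs t] is invariant, [v_(t+1) - v_t P_t] has l1-norm at most
[2 (Z_t - Z_(t+1))] ([deviation_step]): the drift of the invariant measures is a
telescoping quantity, so that only its total matters.  Over [tau] steps ending at
time [m], some column of the transition matrix is bounded below by
[e_m = c m ^ (- q)], with [q = tau L / gamma < 1] ([contraction_block]), and
Doeblin's argument contracts zero-sum vectors by [1 - e_m].  For the energy
[F_t = |v_t|_1 / 2 + y_t] the two facts combine into
  [F_m <= (1 - e_m) F_(m - tau) + e_m y_(m - tau)],
that is, [F] relaxes towards [y] ([energy_relaxation]).

Dividing by [e_m] and summing by parts leaves the increments of [1 / e_m], which
tend to zero because [q < 1]; hence [sum F <= 2 sum y + C] for a constant [C]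
([relaxation_sum]).  The expected cost at time [t] is at most
[Delta F_t / deg a*] ([expected_cost_le]), and the sum over [t <= n] of
[(t + 1) ^ (- s)] is at most [(n + 1) ^ (1 - s) / (1 - s)] if [0 < s < 1].
The regret is therefore at most half of the announced sum plus lower-order terms.
A neighbour [b] of [a*] has [0 < (mu b - mu a* ) / gamma < 1], so its term tends
to infinity, and the spare half of that term absorbs the constants, the
contribution of the states with [(mu a - mu a* ) / gamma >= 1], and the
nonpositive coefficients that such states have in the announced sum
([regret_eventually_le]).  The Gamma term of the bound is nonnegative, and the
asymptotic statement follows by comparing [n + 1] with [2 n]. *)

(** * Power sums and a relaxation inequality *)

Section PowerSums.
Context {R : realType}.
Implicit Types (p q s c x : R).

(** Bernoulli's inequality for exponents below one: Young's inequality for the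
    product of [(1 + x) ^ p] and [1], with conjugate exponents [1/p] and
    [1/(1-p)]. *)
Lemma powR_le1Dx p x : 0 < p <= 1 -> -1 <= x -> (1 + x) `^ p <= 1 + p * x.
Proof.
move=> /andP[p0 p1] x1.
have [->|pn1] := eqVneq p 1; first by rewrite powRr1 ?mul1r//; lra.
have q0 : 0 < 1 - p by move: pn1; rewrite neq_lt => /orP[]; lra.
have /= := @conjugate_powR R ((1 + x) `^ p) 1 p^-1 (1 - p)^-1.
rewrite -powRrM mulfV ?lt0r_neq0// powRr1; last by lra.
rewrite powR1 !invrK mulr1 mul1r => H.
apply: (le_trans (H _ _ _ _ _)); rewrite ?powR_ge0 ?invr_gt0//; lra.
Qed.

(** Each summand is at most the increment of [x ^ (1 - s) / (1 - s)], by
    Bernoulli's inequality at [- x^-1]. *)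
Lemma sum_powRN_le s n : 0 < s < 1 ->
  \sum_(1 <= t < n.+1) (t%:R + 1) `^ (- s) <= (n%:R + 1) `^ (1 - s) / (1 - s).
Proof.
move=> /andP[s0 s1]; have p0 : 0 < 1 - s by lra.
elim: n => [|n IH].
  by rewrite big_geq//; apply: divr_ge0; rewrite ?powR_ge0 ?ltW.
rewrite big_nat_recr//=; apply: (le_trans (lerD IH (lexx _))).
have n0 : 0 <= n%:R :> R by [].
set x : R := n.+1%:R + 1; have x2 : 2 <= x by rewrite /x -natr1; lra.
have x0 : 0 < x by lra.
have -> : n%:R + 1 = x * (1 + (- x^-1)).
  by rewrite /x -natr1; field; rewrite lt0r_neq0//; lra.
rewrite ler_pdivlMr// mulrDl mulfVK ?lt0r_neq0//.
have xV : x^-1 <= 1 by rewrite invf_le1//; lra.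
rewrite powRM; [|lra|lra].
have H : (1 + - x^-1) `^ (1 - s) <= 1 + (1 - s) * (- x^-1).
  by apply: powR_le1Dx; lra.
have E : x `^ (- s) = x `^ (1 - s) * x^-1.
  by rewrite -powR_inv1 ?ltW// -powRD; [congr (_ `^ _); ring|rewrite (gt_eqF x0) implybT].
have := powR_ge0 x (1 - s) => X0.
rewrite E.
have := ler_wpM2l X0 H.
set y := (1 + _) `^ _ ; set X := x `^ _.
nra.
Qed.

Lemma powRN_le1 x s : 1 <= x -> 0 <= s -> x `^ (- s) <= 1.
Proof.
by move=> x1 s0; rewrite -[leRHS](powRr0 x) ler_powR// oppr_le0.
Qed.

Lemma powRDl_le q x d : 0 <= q <= 1 -> 0 < x -> 0 <= d ->
  (x + d) `^ q <= x `^ q + d * x `^ (q - 1).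
Proof.
move=> /andP[q0 q1] x0 d0.
have -> : x + d = x * (1 + d / x) by field; rewrite lt0r_neq0.
have dx : 0 <= d / x by rewrite divr_ge0// ltW.
rewrite powRM; [|lra|lra].
have E : x `^ (q - 1) = x `^ q * x^-1.
  by rewrite -powR_inv1 ?ltW// -powRD//; rewrite (gt_eqF x0) implybT.
have H : (1 + d / x) `^ q <= 1 + d / x by apply: ler1_powR; lra.
have := ler_wpM2l (powR_ge0 x q) H; rewrite E; nra.
Qed.

Lemma powR_unbounded p c : 0 < p ->
  exists M : nat, forall n : nat, (M <= n)%N -> c <= n%:R `^ p.
Proof.
move=> p0; exists (Num.bound (`|c| `^ p^-1)) => n Mn.
have h : `|c| `^ p^-1 <= n%:R.
  apply: (le_trans (ltW (archi_boundP _))); first by rewrite powR_ge0.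
  by rewrite ler_nat.
have := @ge0_ler_powR R p (ltW p0) _ _ _ _ h.
rewrite -powRrM mulVf ?lt0r_neq0// powRr1// => H.
by apply: (le_trans (ler_norm _)); apply: H; rewrite nnegrE ?powR_ge0.
Qed.

(** The sum telescopes along the residue classes modulo [N]; the terms of index
    [n] to [n + N - 1] that it leaves are dropped, being nonnegative. *)
Lemma sum_telescope (b : nat -> R) (N M n : nat) :
  (forall m, (M <= m)%N -> 0 <= b m) ->
  \sum_(M <= m < n) (b m - b (m + N)%N) <= \sum_(M <= m < M + N) b m.
Proof.
move=> b0; have S0 u v : (M <= u)%N -> 0 <= \sum_(u <= m < v) b m.
  move=> Mu; rewrite big_nat_cond; apply: sumr_ge0 => i /andP[/andP[ui _] _].
  by apply: b0; apply: leq_trans ui.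
case: (leqP n M) => [nM|/ltnW Mn]; first by rewrite big_geq// S0.
suff -> : \sum_(M <= m < n) (b m - b (m + N)%N) =
   \sum_(M <= m < M + N) b m - \sum_(n <= m < n + N) b m.
  by rewrite gerBl S0.
elim: n Mn => [|n IH]; first by rewrite leqn0 => /eqP->; rewrite big_geq// subrr.
rewrite leq_eqVlt => /orP[/eqP->|Mn]; first by rewrite big_geq// subrr.
rewrite big_nat_recr//= IH// addSn.
have : b n + \sum_(n.+1 <= m < (n + N).+1) b m
     = \sum_(n <= m < n + N) b m + b (n + N)%N.
  by rewrite -big_ltn ?ltnS ?leq_addr// big_nat_recr ?leq_addr.
lra.
Qed.

(** Averaged form of the fact that a quantity [F] relaxing towards [y] at rate
    [e_m = c m ^ (- q)] eventually follows [y].  Divided by the rate, the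
    hypothesis reads [F_m <= y_m + A_m (F_m - F_(m+N))] with [A = 1 / e].  Since
    [q < 1], the increments [A_(m+N) - A_m] tend to zero, and summation by parts
    loses only a fraction of [sum F], here one half. *)
Lemma relaxation_sum (F y : nat -> R) (N : nat) (q c : R) :
  0 < q < 1 -> 0 < c -> (forall t, 0 <= F t) -> (forall t, 0 <= y t) ->
  (forall m, (0 < m)%N ->
    F (m + N)%N <= F m - c * ((m + N)%:R `^ (- q)) * (F m - y m)) ->
  exists C : R, forall n,
    \sum_(1 <= t < n.+1) F t <= 2 * \sum_(1 <= t < n.+1) y t + C.
Proof.
move=> /andP[q0 q1] c0 F0 y0 rel.
pose A m : R := (m + N)%:R `^ q / c.
pose b m : R := (A m - 2^-1) * F m.
(* From M1 on the increments of A are at most 1/2, and from M2 on A is at least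
   1/2, which makes b nonnegative. *)
have [M1 HM1] : exists M : nat, forall m : nat, (M <= m)%N ->
    2 * N%:R / c <= m%:R `^ (1 - q).
  by apply: powR_unbounded; lra.
have [M2 HM2] := @powR_unbounded q (c / 2) q0.
pose M := (M1 + M2).+1.
have b_ge0 m : (M <= m)%N -> 0 <= b m.
  move=> Mm; apply: mulr_ge0 => //.
  rewrite subr_ge0 /A ler_pdivlMr// mulrC; apply: HM2.
  by rewrite /M in Mm; lia.
have step m : (M <= m)%N -> F m <= 2 * y m + 2 * (b m - b (m + N)%N).
  move=> Mm; have m0 : (0 < m)%N by rewrite /M in Mm; lia.
  have x0 : 0 < (m + N)%:R :> R by rewrite ltr0n addn_gt0 m0.
  have A0 : 0 < A m by rewrite /A divr_gt0 ?powR_gt0.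
  have relA : F m - y m <= A m * (F m - F (m + N)%N).
    have := ler_wpM2l (ltW A0) (rel _ m0).
    have -> : A m * (F m - c * (m + N)%:R `^ (- q) * (F m - y m)) =
              A m * F m - (F m - y m).
      rewrite /A powRN; field.
      by rewrite !lt0r_neq0 ?powR_gt0.
    by rewrite mulrBr; lra.
  have incr : A (m + N)%N <= A m + 2^-1.
    rewrite /A natrD -[leRHS](mulfK (lt0r_neq0 c0)) ler_pM2r ?invr_gt0//.
    rewrite mulrDl divfK ?lt0r_neq0//.
    apply: (le_trans (powRDl_le _ _ _ _ x0 _)) => //; first lra.
    rewrite lerD2l.
    have := HM1 (m + N)%N; rewrite ler_pdivrMr// => H.
    have {}H : 2 * N%:R <= (m + N)%:R `^ (1 - q) * c.
      by apply: H; rewrite /M in Mm; lia.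
    have -> : q - 1 = - (1 - q) by ring.
    by rewrite powRN ler_pdivrMr ?powR_gt0//; lra.
  have := ler_wpM2r (F0 (m + N)%N) incr.
  by rewrite /b; lra.
exists (\sum_(1 <= t < M) F t + 2 * \sum_(M <= m < M + N) b m) => n.
have S0 (f : nat -> R) u v : (forall t, 0 <= f t) -> 0 <= \sum_(u <= m < v) f m.
  by move=> f0; apply: sumr_ge0.
have T0 : 0 <= \sum_(M <= m < M + N) b m.
  rewrite big_nat_cond; apply: sumr_ge0 => i /andP[/andP[ui _] _].
  exact: b_ge0.
case: (leqP n.+1 M) => nM.
  rewrite [\sum_(1 <= t < M) _](big_cat_nat (ltn0Sn n) nM)//=.
  have := S0 F n.+1 M F0; have := S0 y 1%N n.+1 y0; lra.
have M1' : (1 <= M)%N by [].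
rewrite (big_cat_nat M1' (ltnW nM))//= [X in 2 * X](big_cat_nat M1' (ltnW nM))//=.
have : \sum_(M <= m < n.+1) F m <=
   2 * \sum_(M <= m < n.+1) y m + 2 * \sum_(M <= m < n.+1) (b m - b (m + N)%N).
  rewrite !mulr_sumr -big_split/= big_nat_cond [leRHS]big_nat_cond.
  by apply: ler_sum => i /andP[/andP[Mi _] _]; apply: step.
have := sum_telescope b N M n.+1 b_ge0.
have := S0 y 1%N M y0; lra.
Qed.

Lemma powR_dominates (p p' A B c : R) : 0 <= p' < p -> 0 < c -> 0 <= A -> 0 <= B ->
  exists M : nat, forall n : nat, (M <= n)%N ->
    A + B * (n%:R + 1) `^ p' <= c * (n%:R + 1) `^ p.
Proof.
move=> /andP[p'0 pp'] c0 A0 B0.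
have [M HM] := @powR_unbounded (p - p') ((A + B) / c) ltac:(lra).
exists M => n Mn.
have := HM n.+1 (leqW Mn); rewrite -natr1 ler_pdivrMr//.
set x : R := n%:R + 1 => H.
have x1 : 1 <= x by rewrite /x lerDr.
have X1 : 1 <= x `^ p' by rewrite -(powRr0 x) ler_powR.
have -> : p = (p - p') + p' by ring.
rewrite powRD; last by rewrite gt_eqF ?implybT//; lra.
have := ler_wpM2r (powR_ge0 x p') H.
have := ler_wpM2l A0 X1; lra.
Qed.

End PowerSums.

(** * Stochastic matrices and Doeblin contraction *)

Section StochasticMatrices.
Context {R : realType} {k : nat}.
Implicit Types (M : 'M[R]_k) (v : 'rV[R]_k).

Definition stochastic M : Prop :=
  (forall i j, 0 <= M i j) /\ (forall i, \sum_j M i j = 1).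

Definition norm1 v : R := \sum_i `|v 0 i|.

Lemma norm1_ge0 v : 0 <= norm1 v.
Proof. by apply: sumr_ge0. Qed.

Lemma norm1D u v : norm1 (u + v) <= norm1 u + norm1 v.
Proof.
by rewrite /norm1 -big_split; apply: ler_sum => i _; rewrite mxE ler_normD.
Qed.

Lemma stochastic1 : stochastic 1.
Proof.
split=> [i j|i]; first by rewrite mxE; case: (_ == _).
by under eq_bigr do rewrite mxE; rewrite (bigD1 i)//= eqxx big1 ?addr0// => j /negPf;
  rewrite eq_sym => ->.
Qed.

Lemma stochasticM M1 M2 : stochastic M1 -> stochastic M2 -> stochastic (M1 * M2).
Proof.
move=> [p1 s1] [p2 s2]; split=> [i j|i].
  by rewrite mxE; apply: sumr_ge0 => l _; apply: mulr_ge0.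
under eq_bigr do rewrite mxE.
rewrite exchange_big/=; under eq_bigr do rewrite -mulr_sumr s2 mulr1.
exact: s1.
Qed.

(** As [v] has sum zero, subtracting the constant [e] from column [s] does not
    change [v *m M], and it leaves a nonnegative matrix with row sums [1 - e]. *)
Lemma doeblin_contraction M v s (e : R) : stochastic M ->
  (forall i, e <= M i s) -> \sum_i v 0 i = 0 ->
  norm1 (v *m M) <= (1 - e) * norm1 v.
Proof.
move=> [p sM] eM v0.
pose M' i j := M i j - e * (j == s)%:R.
have M'0 i j : 0 <= M' i j.
  by rewrite /M'; case: eqP => [->|_]; rewrite ?mulr1 ?mulr0 ?subr0// subr_ge0.
have vM j : (v *m M) 0 j = \sum_i v 0 i * M' i j.
  rewrite mxE; under [RHS]eq_bigr do rewrite /M' mulrBr.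
  by rewrite sumrB -[X in _ - X]mulr_suml v0 mul0r subr0.
rewrite /norm1.
apply: (@le_trans _ _ (\sum_j \sum_i `|v 0 i| * M' i j)).
  apply: ler_sum => j _; rewrite vM; apply: (le_trans (ler_norm_sum _ _ _)).
  by apply: ler_sum => i _; rewrite normrM (ger0_norm (M'0 _ _)).
rewrite exchange_big/= mulr_sumr; apply: ler_sum => i _.
rewrite -mulr_sumr mulrC /M' sumrB sM -mulr_sumr.
by rewrite (bigD1 s)//= eqxx big1 ?addr0 ?mulr1// => j /negPf->.
Qed.

Lemma norm1_mul_stochastic M v : stochastic M -> norm1 (v *m M) <= norm1 v.
Proof.
move=> [p sM]; rewrite /norm1.
apply: (@le_trans _ _ (\sum_j \sum_i `|v 0 i| * M i j)).
  apply: ler_sum => j _; rewrite mxE; apply: (le_trans (ler_norm_sum _ _ _)).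
  by apply: ler_sum => i _; rewrite normrM (ger0_norm (p _ _)).
rewrite exchange_big/=; apply: ler_sum => i _.
by rewrite -mulr_sumr sM mulr1.
Qed.

Section Products.
Variable P : nat -> 'M[R]_k.
Hypothesis P_stoch : forall t, stochastic (P t).

Lemma transition_id m : transition P m m = 1.
Proof. by rewrite /transition big_geq. Qed.

Lemma transitionS m n :
  transition P m (m + n).+1 = transition P m (m + n) * P (m + n)%N.
Proof. by rewrite /transition big_nat_recr ?leq_addr. Qed.

Lemma transitionSl m n : (m < n)%N ->
  transition P m n = P m * transition P m.+1 n.
Proof. by move=> mn; rewrite /transition big_ltn. Qed.

Lemma stochastic_transition m n : stochastic (transition P m n).
Proof.
apply: big_ind => //; [exact: stochastic1|exact: stochasticM].
Qed.

(** A positive entry of a product of nonnegative matrices has a positive path,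
    and that path alone contributes [e ^+ n]. *)
Lemma transition_gt0_ge (e : R) m n i j : 0 <= e ->
  (forall t x y, (m <= t < m + n)%N -> 0 < P t x y -> e <= P t x y) ->
  0 < transition P m (m + n) i j -> e ^+ n <= transition P m (m + n) i j.
Proof.
move=> e0; elim: n j => [|n IH] j He.
  by rewrite addn0 transition_id mxE; case: (_ == _); rewrite ?expr0// ltxx.
rewrite addnS transitionS mxE => H.
have [p0 _] := stochastic_transition m (m + n).
have [l _ Hl] : exists2 l, true & 0 < transition P m (m + n) i l * P (m + n)%N l j.
  apply: contrapT => H'; move: H; rewrite ltNge => /negP; apply.
  apply: sumr_le0 => l _; rewrite leNgt; apply/negP => Hl.
  by apply: H'; exists l.
have tl : 0 < transition P m (m + n) i l.
  by rewrite lt_neqAle p0 andbT; apply: contraTneq Hl => <-; rewrite mul0r ltxx.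
have Pl : 0 < P (m + n)%N l j by rewrite pmulr_rgt0 in Hl.
rewrite (bigD1 l)//= ler_wpDr//.
  by apply: sumr_ge0 => x _; apply: mulr_ge0 => //; exact: (P_stoch _).1.
rewrite exprSr ler_pM ?exprn_ge0//.
  by apply: IH => // t x y /andP[mt tn]; apply: He; rewrite mt ltnW// addnS ltnS.
by apply: He => //; rewrite leq_addr addnS ltnS leqnn.
Qed.

(** Later stochastic steps do not amplify the one-step errors, so their bounds
    add up, and they telescope. *)
Lemma norm1_perturbed (v : nat -> 'rV[R]_k) (z : nat -> R) m n :
  (forall t, norm1 (v t.+1 - v t *m P t) <= z t - z t.+1) ->
  norm1 (v (m + n)%N - v m *m transition P m (m + n)) <= z m - z (m + n)%N.
Proof.
move=> H; elim: n => [|n IH].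
  rewrite addn0 transition_id mulmx1 !subrr /norm1 big1// => i _.
  by rewrite mxE normr0.
rewrite addnS transitionS.
have -> : v (m + n).+1 - v m *m (transition P m (m + n) * P (m + n)%N) =
  (v (m + n).+1 - v (m + n)%N *m P (m + n)%N) +
  (v (m + n)%N - v m *m transition P m (m + n)) *m P (m + n)%N.
  by rewrite mulmxBl -mulmxA subrKA.
apply: (le_trans (norm1D _ _)).
have := H (m + n)%N; have := norm1_mul_stochastic _ (v (m + n)%N - v m *m transition P m (m + n)) (P_stoch (m + n)).
lra.
Qed.
End Products.
End StochasticMatrices.

(** * Marginal laws of the chain *)

Section Marginals.
Context {R : realType} {k : nat} (P : nat -> 'M[R]_k).
Context {d : measure_display} {Omega : measurableType d}.
Context (Pr : probability Omega R) (a : nat -> Omega -> 'I_k).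
Hypothesis chain : markov_chain P Pr a.

Lemma measurable_history u t (x : nat -> 'I_k) :
  measurable [set w | forall s, (u <= s <= t)%N -> a s w = x s].
Proof.
have [ma _] := chain.
rewrite (_ : mkset _ = \bigcap_(s in [set s | (u <= s <= t)%N]) [set w | a s w = x s]).
  by apply: bigcap_measurableType => // s _; exact: ma.
by apply/seteqP; split=> w /= H s; apply: H.
Qed.

Lemma probability_split (A : set Omega) t : measurable A ->
  Pr A = (\sum_(i < k) Pr (A `&` [set w | a t w = i]))%E.
Proof.
move=> mA; have [ma _] := chain.
rewrite -(@measure_semi_additive_ord _ _ _ Pr _ (fun i : 'I_k => A `&` [set w | a t w = i])).
- congr (Pr _); rewrite -bigcup_seq.
  apply/seteqP; split=> w; last by move=> [i _ []].
  by move=> Aw; exists (a t w) => //=; rewrite mem_index_enum.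
- by move=> i; apply: measurableI => //; exact: ma.
- move=> i j _ _ [w [[_ /= ai] [_ /= aj]]].
  by rewrite -ai -aj.
- by apply: bigsetU_measurable => i _; apply: measurableI => //; exact: ma.
Qed.

(** The Markov property for complete histories passes to histories over a window
    [u, t+1], by summing over the state at the first time of the window.  The
    case [u = t] is the two-time law, from which the evolution of the marginals
    follows. *)
Lemma markov_window u t (x : nat -> 'I_k) : (u <= t)%N ->
  Pr [set w | forall s, (u <= s <= t.+1)%N -> a s w = x s] =
  (Pr [set w | forall s, (u <= s <= t)%N -> a s w = x s]
     * (P t (x t) (x t.+1))%:E)%E.
Proof.
elim: u x => [|u IH] x ut.
  by have [_ /(_ t x)] := chain.
pose x' i s := if s == u then i else x s.
have split_at v : (u < v)%N ->
    Pr [set w | forall s, (u < s <= v)%N -> a s w = x s] =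
    (\sum_(i < k) Pr [set w | forall s, (u <= s <= v)%N -> a s w = x' i s])%E.
  move=> uv; rewrite (probability_split _ u (measurable_history _ _ _)).
  apply: eq_bigr => i _; congr (Pr _); apply/seteqP; split=> w /=.
    move=> [H ai] s; rewrite /x'; case: eqP => [-> //|/eqP su] /andP[us sv].
    by apply: H; rewrite sv andbT ltn_neqAle eq_sym su.
  move=> H; split=> [s /andP[us sv]|].
    by rewrite H ?sv ?(ltnW us)// /x' gtn_eqF.
  by rewrite H ?leqnn ?(ltnW uv)// /x' eqxx.
rewrite split_at; last by apply: ltnW.
rewrite split_at//.
have neq v : (u < v)%N -> (v == u) = false by move=> uv; rewrite gtn_eqF.
under eq_bigr do rewrite (IH _ (ltnW ut)) /x' (neq _ ut) (neq t.+1 (ltnW ut)).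
by rewrite ge0_sume_distrl.
Qed.

Definition marginal t : 'rV[R]_k := \row_i fine (Pr [set w | a t w = i]).

Lemma marginal_ge0 t i : 0 <= marginal t 0 i.
Proof. by rewrite mxE fine_ge0. Qed.

Lemma sum_marginal t : \sum_i marginal t 0 i = 1.
Proof.
have [ma _] := chain.
apply: EFin_inj; rewrite -sumEFin -(probability_setT Pr).
rewrite (probability_split _ t measurableT).
apply: eq_bigr => i _; rewrite mxE setTI fineK//.
by apply: fin_num_measure; apply: ma.
Qed.

Lemma marginalS t : marginal t.+1 = marginal t *m P t.
Proof.
have [ma _] := chain.
apply/rowP => j; rewrite !mxE; apply: EFin_inj.
rewrite fineK; last by apply: fin_num_measure; apply: ma.
rewrite (probability_split _ t (ma _ _)) -sumEFin; apply: eq_bigr => i _.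
rewrite mxE EFinM fineK; last by apply: fin_num_measure; apply: ma.
pose x s := if s == t then i else j.
have := markov_window t t x (leqnn t).
rewrite /x eqxx gtn_eqF// => markov.
have window1 : [set w | a t w = i] =
    [set w | forall s, (t <= s <= t)%N -> a s w = if s == t then i else j].
  apply/seteqP; split=> w /=; last by move=> H; rewrite H ?leqnn// eqxx.
  by move=> ai s; rewrite -eqn_leq => /eqP <-; rewrite eqxx.
rewrite [in RHS]window1 -markov; congr (Pr _); apply/seteqP; split=> w /=.
  move=> [atj ati] s; rewrite [(s <= _)%N]leq_eqVlt ltnS => /andP[ts /orP[/eqP->|st]].
    by rewrite gtn_eqF.
  have -> : s = t by apply/eqP; rewrite eqn_leq st ts.
  by rewrite eqxx.
move=> H; split.
  by rewrite H ?leqnn ?leqnSn// gtn_eqF.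
by rewrite H ?leqnn ?leqnSn// eqxx.
Qed.
End Marginals.


(** * The annealing matrices *)

Section Annealing.
Context {R : realType} {k : nat} (mu : 'I_k -> R) (astar : 'I_k).
Context (adj : rel 'I_k) (g : 'I_k -> 'I_k -> R) (gamma : R).
Hypothesis k_ge2 : (2 <= k)%N.
Hypothesis astar_min : forall i, i != astar -> mu astar < mu i.
Hypothesis adj_sym : symmetric adj.
Hypothesis adj_irr : irreflexive adj.
Hypothesis adj_conn : forall i j, connect adj i j.
Hypothesis g1 : forall i j, adj i j -> g i j = 1.
Hypothesis gamma_gt0 : 0 < gamma.

Local Notation deg := (node_weight adj g).
Local Notation P := (annealing_matrix adj mu g (log_cooling gamma)).
Local Notation L := (max_step adj mu).

Definition uphill x y : R := Num.max 0 (mu y - mu x) / gamma.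

Lemma uphill_ge0 x y : 0 <= uphill x y.
Proof. by rewrite divr_ge0 ?le_max ?lexx// ltW. Qed.

Lemma time_ge1 (t : nat) : 1 <= t%:R + 1 :> R.
Proof. by rewrite lerDr. Qed.

Lemma time_gt0 (t : nat) : 0 < t%:R + 1 :> R.
Proof. exact: lt_le_trans ltr01 (time_ge1 t). Qed.

(** With the logarithmic schedule Gibbs factors are powers of time; at time 0 the
    base is 1, which matches the infinite initial temperature. *)
Lemma acceptanceE t x y :
  acceptance mu (log_cooling gamma t) x y = (t%:R + 1) `^ (- uphill x y).
Proof.
case: t => [|t]; first by rewrite /= add0r powR1.
rewrite /= /powR gt_eqF ?time_gt0//; congr expR.
by rewrite /uphill invf_div; ring.
Qed.

Lemma acceptance_le1 t x y : acceptance mu (log_cooling gamma t) x y <= 1.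
Proof. by rewrite acceptanceE powRN_le1 ?time_ge1 ?uphill_ge0. Qed.

Lemma adj_exists x : exists y, adj x y.
Proof.
have [y yx] : exists y : 'I_k, y != x.
  case: (boolP (x == Ordinal (ltnW k_ge2))) => [/eqP->|?].
    by exists (Ordinal k_ge2).
  by exists (Ordinal (ltnW k_ge2)); rewrite eq_sym.
have /connectP[[|z p] /= xp yE] := adj_conn x y; first by rewrite yE eqxx in yx.
by exists z; case/andP: xp.
Qed.

Lemma degE x : deg x = #|[pred y | adj x y]|%:R.
Proof.
by rewrite /node_weight (eq_bigr _ (fun y => @g1 x y)) sumr_const.
Qed.

Lemma deg_gt0 x : 0 < deg x.
Proof.
rewrite degE ltr0n; apply/card_gt0P; have [y] := adj_exists x.
by exists y.
Qed.

Lemma deg_le x : deg x <= k%:R.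
Proof. by rewrite degE ler_nat -[leqRHS]card_ord max_card. Qed.

Lemma annealing_moveE t x y : adj x y ->
  annealing_move adj mu g (log_cooling gamma t) x y =
  (t%:R + 1) `^ (- uphill x y) / deg x.
Proof.
by move=> xy; rewrite /annealing_move xy g1// mul1r acceptanceE mulrC.
Qed.

Lemma annealing_move_ge0 t x y :
  0 <= annealing_move adj mu g (log_cooling gamma t) x y.
Proof.
case: (boolP (adj x y)) => [xy|/negPf xy]; last by rewrite /annealing_move xy.
by rewrite annealing_moveE// divr_ge0 ?powR_ge0// ltW// deg_gt0.
Qed.

Lemma annealing_offdiag t x y : x != y ->
  P t x y = annealing_move adj mu g (log_cooling gamma t) x y.
Proof. by rewrite mxE => /negPf->. Qed.

Lemma annealing_diag t x :
  P t x x = \sum_(z | adj x z) (1 - (t%:R + 1) `^ (- uphill x z)) / deg x.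
Proof.
rewrite mxE eqxx; under eq_bigr do rewrite annealing_moveE//.
rewrite -[X in X - _](divff (lt0r_neq0 (deg_gt0 x))) -!mulr_suml -mulrBl.
by congr (_ / _); rewrite sumrB {1}/node_weight (eq_bigr _ (fun y => @g1 x y)).
Qed.

Lemma annealing_ge0 t x y : 0 <= P t x y.
Proof.
case: (eqVneq x y) => [<-|xy]; last first.
  by rewrite annealing_offdiag// annealing_move_ge0.
rewrite annealing_diag; apply: sumr_ge0 => z _.
rewrite divr_ge0 ?(ltW (deg_gt0 _))// subr_ge0 -acceptanceE.
exact: acceptance_le1.
Qed.

Lemma annealing_stochastic t : stochastic (P t).
Proof.
split=> [i j|x]; first exact: annealing_ge0.
rewrite (bigD1 x)//= mxE eqxx.
rewrite [X in _ + X](_ : _ =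
    \sum_(y | adj x y) annealing_move adj mu g (log_cooling gamma t) x y).
  by rewrite subrK.
rewrite big_mkcond [RHS]big_mkcond; apply: eq_bigr => y _.
case: eqVneq => [->|yx] /=; first by rewrite adj_irr.
by rewrite annealing_offdiag 1?eq_sym// /annealing_move; case: ifP.
Qed.

(** Left unnormalised: in this form each weight is nonincreasing in time, and the
    one of [astar] is constant. *)
Definition gibbs (t : nat) x : R :=
  deg x * (t%:R + 1) `^ (- ((mu x - mu astar) / gamma)).

Lemma gibbs_ge0 t x : 0 <= gibbs t x.
Proof. by rewrite mulr_ge0 ?powR_ge0// ltW// deg_gt0. Qed.

Lemma gap_ge0 x : 0 <= (mu x - mu astar) / gamma.
Proof.
rewrite divr_ge0 ?(ltW gamma_gt0)// subr_ge0.
by case: (eqVneq x astar) => [->//|/astar_min/ltW].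
Qed.

Lemma gibbs_astar t : gibbs t astar = deg astar.
Proof. by rewrite /gibbs subrr mul0r oppr0 powRr0 mulr1. Qed.

Lemma gibbsS_le t x : gibbs t.+1 x <= gibbs t x.
Proof.
rewrite /gibbs ler_wpM2l// ?(ltW (deg_gt0 _))//.
rewrite !powRN lef_pV2 ?posrE ?powR_gt0 ?time_gt0//.
apply: ge0_ler_powR; rewrite ?gap_ge0 ?nnegrE ?(ltW (time_gt0 _))//.
by rewrite lerD2r ler_nat.
Qed.

Lemma detailed_balance t x y : gibbs t x * P t x y = gibbs t y * P t y x.
Proof.
wlog le_mu : x y / mu x <= mu y.
  by move=> H; case: (lerP (mu x) (mu y)) => [|/ltW] /H.
case: (eqVneq x y) => [->//|xy].
rewrite !annealing_offdiag// 1?eq_sym//.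
case: (boolP (adj x y)) => [a|/negPf na]; last first.
  by rewrite /annealing_move (adj_sym y x) na !mulr0.
rewrite !annealing_moveE ?(adj_sym y x)// /gibbs /uphill.
rewrite max_r ?subr_ge0// max_l ?subr_le0// mul0r oppr0 powRr0.
set z : R := _ + 1; have z0 : 0 < z by exact: time_gt0.
have -> : - ((mu y - mu astar) / gamma) =
    - ((mu x - mu astar) / gamma) + - ((mu y - mu x) / gamma).
  by field; rewrite lt0r_neq0.
rewrite powRD; last by rewrite (gt_eqF z0) implybT.
by field; rewrite !lt0r_neq0 ?deg_gt0.
Qed.

Lemma gibbs_stationary t y : \sum_x gibbs t x * P t x y = gibbs t y.
Proof.
under eq_bigr do rewrite detailed_balance.
by rewrite -mulr_sumr (annealing_stochastic t).2 mulr1.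
Qed.

Lemma annealing_adj_gt0 t x y : adj x y -> 0 < P t x y.
Proof.
move=> xy; have neq : x != y.
  by apply: contraTneq xy => ->; rewrite adj_irr.
by rewrite annealing_offdiag// annealing_moveE// divr_gt0 ?powR_gt0 ?time_gt0 ?deg_gt0.
Qed.

(** The chain may stay at [astar], since a proposed move to a neighbour goes
    uphill and is refused with positive probability. *)
Lemma annealing_astar_gt0 t : (0 < t)%N -> 0 < P t astar astar.
Proof.
move=> t0; have [z az] := adj_exists astar.
have zn : z != astar by apply: contraTneq az => ->; rewrite adj_irr.
rewrite annealing_diag (bigD1 z)//= ltr_wpDr//.
  apply: sumr_ge0 => i _; rewrite divr_ge0 ?(ltW (deg_gt0 _))// subr_ge0.
  by rewrite powRN_le1 ?time_ge1 ?uphill_ge0.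
rewrite divr_gt0 ?deg_gt0// subr_gt0 powRN invf_lt1 ?powR_gt0 ?time_gt0//.
have u0 : 0 < uphill astar z.
  by rewrite divr_gt0// lt_max subr_gt0 astar_min// orbT.
apply: (@le_lt_trans _ _ (1 `^ uphill astar z)); first by rewrite powR1.
by apply: gt0_ltr_powR; rewrite ?nnegrE ?(ltW (time_gt0 _))// ltrDr ltr0n.
Qed.

Lemma annealing_diag_mono t x : (0 < t)%N -> P 1 x x <= P t x x.
Proof.
move=> t0; rewrite !annealing_diag; apply: ler_sum => z _.
rewrite ler_pM2r ?invr_gt0 ?deg_gt0// lerD2l lerN2.
rewrite !powRN lef_pV2 ?posrE ?powR_gt0 ?time_gt0//.
apply: ge0_ler_powR; rewrite ?uphill_ge0 ?nnegrE ?(ltW (time_gt0 _))//.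
by rewrite lerD2r ler_nat.
Qed.

Lemma annealing_diag_pattern t x : 0 < P t x x -> 0 < P 1 x x.
Proof.
rewrite !lt_neqAle !annealing_ge0 !andbT; apply: contra => /eqP P1.
rewrite eq_sym annealing_diag big1// => z xz.
suff -> : uphill x z = 0 by rewrite oppr0 powRr0 subrr mul0r.
move: P1 => /esym; rewrite annealing_diag => /eqP.
rewrite psumr_eq0; last first.
  move=> i _; rewrite divr_ge0 ?(ltW (deg_gt0 _))// subr_ge0.
  by rewrite powRN_le1 ?time_ge1 ?uphill_ge0.
move=> /allP/(_ z); rewrite mem_index_enum xz => /(_ isT) /=.
rewrite mulf_eq0 invr_eq0 (gt_eqF (deg_gt0 x)) orbF subr_eq0 eq_sym powR_eq1.
rewrite -(natrD _ 1 1) pnatr_eq1/= ltrn0/= oppr_eq0.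
by move=> /eqP.
Qed.

Lemma step_le_max x y : adj x y -> `|mu y - mu x| <= L.
Proof.
move=> xy; rewrite /max_step; apply: le_trans (le_bigmax _ _ x).
exact: (le_bigmax_cond _ (fun j => `|mu j - mu x|) xy).
Qed.

Lemma max_step_ge0 : 0 <= L.
Proof. exact: bigmax_ge_id. Qed.

(** A move to a neighbour costs at most the largest step [L].  A positive
    holding probability stays away from zero, as it is nondecreasing for positive
    times, so it is covered by the constant. *)
Lemma positive_entry_ge : exists2 c : R, 0 < c &
  forall t x y, (0 < t)%N -> 0 < P t x y ->
    c * (t%:R + 1) `^ (- (L / gamma)) <= P t x y.
Proof.
pose c : R := \big[Num.min/k%:R^-1]_(x | 0 < P 1 x x) P 1 x x.
have k0 : 0 < k%:R :> R by rewrite ltr0n (leq_trans _ k_ge2).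
have c0 : 0 < c by apply: lt_bigmin => //; rewrite invr_gt0.
exists c => // t x y t0 pos.
case: (eqVneq x y) pos => [<-|xy] pos.
  apply: le_trans (annealing_diag_mono t x t0).
  apply: (@le_trans _ _ c).
    by rewrite ger_pMr// powRN_le1 ?time_ge1// divr_ge0 ?max_step_ge0// ltW.
  by apply: bigmin_le_cond; apply: annealing_diag_pattern pos.
move: pos; rewrite annealing_offdiag//.
case: (boolP (adj x y)) => [a|/negPf na]; last by rewrite /annealing_move na ltxx.
move=> _; rewrite annealing_moveE// mulrC ler_pM ?powR_ge0 ?(ltW c0)//.
  rewrite ler_powR ?time_ge1// lerN2 ler_pM2r ?invr_gt0//.
  rewrite ge_max max_step_ge0/=; exact: le_trans (ler_norm _) (step_le_max _ _ a).
apply: (@le_trans _ _ k%:R^-1); first exact: bigmin_le_id.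
by rewrite lef_pV2 ?posrE ?deg_gt0// deg_le.
Qed.

(** Follow the path, then wait at [astar] for the remaining steps. *)
Lemma transition_astar_gt0 m n i p : (0 < m)%N -> path adj i p ->
  last i p = astar -> (size p <= n)%N -> 0 < transition P m (m + n) i astar.
Proof.
elim: n m i p => [|n IH] m i p m0.
  case: p => // _ /= -> _; rewrite addn0 transition_id mxE eqxx; exact: ltr01.
move=> ip il sp; rewrite transitionSl ?addnS ?ltnS ?leq_addr// mxE.
have [st _] := stochastic_transition P annealing_stochastic m.+1 (m + n).+1.
have step y : 0 < P m i y -> 0 < transition P m.+1 (m + n).+1 y astar ->
    0 < \sum_j P m i j * transition P m.+1 (m + n).+1 j astar.
  move=> py ty; rewrite (bigD1 y)//= ltr_wpDr ?mulr_gt0//.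
  by apply: sumr_ge0 => j _; rewrite mulr_ge0 ?annealing_ge0.
rewrite -addSn in step st *.
case: p ip il sp => [_ /= ia _|y p /= /andP[iy yp] yl sp].
  by apply: (step astar); [rewrite ia annealing_astar_gt0|exact: (IH _ _ [::])].
by apply: (step y); [exact: annealing_adj_gt0|exact: (IH _ _ p)].
Qed.

(** Any lag longer than all the chosen paths to [astar] makes column [astar]
    positive. *)
Lemma contracting_lag_exists : exists2 tau, (0 < tau)%N & contracting_lag P tau.
Proof.
have paths i : exists p, path adj i p /\ last i p = astar.
  by have /connectP[p ip ->] := adj_conn i astar; exists p.
have [p pP] := choice paths.
exists (\max_i size (p i)).+1 => // m lt_m.
set tau := (\max_i _).+1 in lt_m *.
apply: (lt_le_trans _ (le_bigmax _ _ astar)).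
apply: lt_bigmin => // i _; have [ip il] := pP i.
rewrite -{2}(subnK (ltnW lt_m)); apply: (transition_astar_gt0 _ _ _ (p i)) => //.
  by rewrite subn_gt0.
by rewrite leqW// (leq_bigmax i).
Qed.

Lemma contraction_timeP :
  (0 < contraction_time P)%N /\ contracting_lag P (contraction_time P).
Proof.
have [tau0 tau0_gt0 lag0] := contracting_lag_exists.
have ex : exists n, (0 < n)%N && `[< contracting_lag P n >].
  by exists tau0; rewrite tau0_gt0; apply/asboolP.
have [n /andP[n0 /asboolP lagn] nmin] := ex_minnP ex.
suff least : exists n, [/\ (0 < n)%N, contracting_lag P n &
    forall u, (0 < u)%N -> contracting_lag P u -> (n <= u)%N].
  by have [] := xgetPex 0%N least.
exists n; split=> // u u0 lagu; apply: nmin.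
by rewrite u0; apply/asboolP.
Qed.

(** Doeblin minorisation over one contraction time: each of the [N] steps of a
    positive path contributes a factor of order [t ^ (- L / gamma)]. *)
Lemma contraction_block : let N := contraction_time P in
  exists2 c : R, 0 < c & forall m, (0 < m)%N ->
    exists s, forall i,
      c * (m + N)%:R `^ (- (N%:R * L / gamma)) <= transition P m (m + N) i s.
Proof.
have [N0 lagN] := contraction_timeP.
set N := contraction_time P in N0 lagN *.
have [c c0 cP] := positive_entry_ge.
exists (c ^+ N); first by rewrite exprn_gt0.
move=> m m0; have := lagN (m + N)%N; rewrite addnK => /(_ _).
rewrite -{1}[N]add0n ltn_add2r m0 => /(_ isT) pos.
have [s spos] : exists s, 0 < \big[Num.min/1]_i transition P m (m + N) i s.
  apply: contrapT => H; move: pos; rewrite ltNge => /negP; apply.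
  apply: bigmax_le => // s _; rewrite leNgt; apply/negP => spos.
  by apply: H; exists s.
exists s => i.
have mN0 : 0 < (m + N)%:R :> R by rewrite ltr0n addn_gt0 m0.
have -> : c ^+ N * (m + N)%:R `^ (- (N%:R * L / gamma)) =
    (c * (m + N)%:R `^ (- (L / gamma))) ^+ N.
  rewrite exprMn -[in RHS](powR_mulrn N (powR_ge0 _ _)) -powRrM.
  by congr (_ * _ `^ _); ring.
apply: (transition_gt0_ge P annealing_stochastic).
- by rewrite mulr_ge0 ?powR_ge0 ?ltW.
- move=> t x y /andP[mt tn] pxy; apply: le_trans (cP t x y (leq_trans m0 mt) pxy).
  rewrite ler_pM2l// !powRN lef_pV2 ?posrE ?powR_gt0 ?time_gt0//.
  apply: ge0_ler_powR; rewrite ?nnegrE ?(ltW (time_gt0 _))//.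
    by rewrite divr_ge0 ?max_step_ge0// ltW.
  by rewrite natr1 ler_nat.
- by apply: (lt_le_trans spos); exact: bigmin_le.
Qed.


(** * Energy and regret *)

Context {d : measure_display} {Omega : measurableType d}.
Context (Pr : probability Omega R) (a : nat -> Omega -> 'I_k).
Hypothesis chain : markov_chain P Pr a.

Local Notation nu := (marginal Pr a).
Local Notation N := (contraction_time P).
Local Notation q := (N%:R * L / gamma).
Local Notation Delta := (max_gap mu astar).

Definition mass t : R := \sum_x gibbs t x.

Definition excess_mass t : R := mass t - deg astar.

(** The distance to equilibrium, scaled by the mass of the Gibbs weights so that
    comparing consecutive times requires no normalisation. *)
Definition deviation t : 'rV[R]_k := mass t *: nu t - \row_x gibbs t x.

(** Adding the excess mass to half the deviation turns the drift of the Gibbs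
    weights, a decrement of the mass, into a decrement of the energy itself. *)
Definition energy t : R := norm1 (deviation t) / 2 + excess_mass t.

Lemma excess_massE t : excess_mass t = \sum_(x | x != astar) gibbs t x.
Proof. by rewrite /excess_mass /mass (bigD1 astar)//= gibbs_astar; ring. Qed.

Lemma excess_mass_ge0 t : 0 <= excess_mass t.
Proof. by rewrite excess_massE; apply: sumr_ge0 => x _; exact: gibbs_ge0. Qed.

Lemma massS_le t : mass t.+1 <= mass t.
Proof. by apply: ler_sum => x _; exact: gibbsS_le. Qed.

Lemma deviationE t i : deviation t 0 i = mass t * nu t 0 i - gibbs t i.
Proof. by rewrite !mxE. Qed.

Lemma sum_deviation t : \sum_i deviation t 0 i = 0.
Proof.
under eq_bigr do rewrite deviationE.
by rewrite sumrB -mulr_sumr (sum_marginal _ _ _ chain) mulr1 subrr.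
Qed.

(** By stationarity only the change of the weights from [t] to [t.+1] remains.
    It enters once through the scaling and once through the weights, each time
    with l1-norm [mass t - mass t.+1]. *)
Lemma deviation_step t :
  norm1 (deviation t.+1 - deviation t *m P t) <= 2 * mass t - 2 * mass t.+1.
Proof.
have devP : deviation t *m P t = mass t *: nu t.+1 - \row_x gibbs t x.
  rewrite mulmxBl -scalemxAl -(marginalS _ _ _ chain); congr (_ - _).
  apply/rowP => y; rewrite !mxE -(gibbs_stationary t y).
  by apply: eq_bigr => x _; rewrite !mxE.
rewrite devP /norm1.
apply: (@le_trans _ _ (\sum_i ((mass t - mass t.+1) * nu t.+1 0 i
                              + (gibbs t i - gibbs t.+1 i)))).
  apply: ler_sum => i _.
  have -> : (deviation t.+1 - (mass t *: nu t.+1 - \row_x gibbs t x)) 0 i =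
      - ((mass t - mass t.+1) * nu t.+1 0 i) + (gibbs t i - gibbs t.+1 i).
    by rewrite !mxE; ring.
  apply: (le_trans (ler_normD _ _)); rewrite normrN.
  rewrite !ger0_norm ?subr_ge0 ?gibbsS_le//.
  by rewrite mulr_ge0 ?subr_ge0 ?massS_le ?marginal_ge0.
rewrite big_split/= -mulr_sumr (sum_marginal _ _ _ chain) mulr1 sumrB -!/(mass _).
lra.
Qed.

Lemma energy_ge0 t : 0 <= energy t.
Proof. by rewrite addr_ge0 ?excess_mass_ge0// divr_ge0 ?norm1_ge0. Qed.

(** Doeblin contraction of the zero-sum deviation; the accumulated drift
    telescopes to the loss of excess mass over the block. *)
Lemma energy_relaxation : exists2 c : R, 0 < c & forall m, (0 < m)%N ->
  energy (m + N)%N <=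
    energy m - c * (m + N)%:R `^ (- q) * (energy m - excess_mass m).
Proof.
have [c c0 block] := contraction_block; exists c => // m m0.
have [s es] := block m m0.
have st := stochastic_transition P annealing_stochastic m (m + N).
have := doeblin_contraction _ _ _ _ st es (sum_deviation m).
have := norm1_perturbed P annealing_stochastic deviation _ m N deviation_step.
have := norm1D (deviation (m + N)%N - deviation m *m transition P m (m + N))
  (deviation m *m transition P m (m + N)).
rewrite subrK /energy /excess_mass; set e := c * _.
set D := norm1 (deviation m).
lra.
Qed.

Lemma gap_le i : mu i - mu astar <= Delta.
Proof.
case: (eqVneq i astar) => [->|ia]; first by rewrite subrr; exact: bigmax_ge_id.
exact: (le_bigmax_cond _ (fun i => mu i - mu astar) ia).
Qed.

Lemma gap0 i : 0 <= mu i - mu astar.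
Proof. by rewrite subr_ge0; case: (eqVneq i astar) => [->//|/astar_min/ltW]. Qed.

Lemma max_gap_gt0 : 0 < Delta.
Proof.
have [b ab] := adj_exists astar.
have ba : b != astar by apply: contraTneq ab => ->; rewrite adj_irr.
by apply: lt_le_trans (gap_le b); rewrite subr_gt0 astar_min.
Qed.

(** The sum of the positive parts of the zero-sum deviation is half its
    l1-norm. *)
Lemma expected_cost_le t :
  \sum_i (mu i - mu astar) * nu t 0 i <= Delta / deg astar * energy t.
Proof.
have D0 := ltW max_gap_gt0.
have nu0 i : 0 <= nu t 0 i by exact: marginal_ge0.
have massD : deg astar <= mass t.
  by rewrite -subr_ge0; exact: excess_mass_ge0.
rewrite mulrAC ler_pdivlMr ?deg_gt0// mulrC.
apply: (@le_trans _ _ (mass t * \sum_i (mu i - mu astar) * nu t 0 i)).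
  by rewrite ler_wpM2r//; apply: sumr_ge0 => i _; rewrite mulr_ge0 ?gap0.
have -> : energy t = \sum_i ((`|deviation t 0 i| + deviation t 0 i) / 2
                             + (if i != astar then gibbs t i else 0)).
  rewrite big_split/= -mulr_suml big_split/= sum_deviation addr0.
  by rewrite -big_mkcond /energy excess_massE.
rewrite !mulr_sumr; apply: ler_sum => i _.
have := ler_norm (deviation t 0 i).
have := ler_norm (- deviation t 0 i); rewrite normrN.
have E := deviationE t i; move: (nu0 i) (gap_le i) (gap0 i).
have M0 : 0 <= mass t by apply: le_trans massD; rewrite ltW ?deg_gt0.
case: eqVneq => [->|ia] n0 g1' g2 d1 d2 /=.
  by rewrite subrr mul0r mulr0 mulr_ge0//; lra.
have X : 0 <= mass t * nu t 0 i by exact: mulr_ge0.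
rewrite mulrCA; apply: (@le_trans _ _ (Delta * (mass t * nu t 0 i))).
  by rewrite ler_wpM2r.
by rewrite ler_wpM2l//; lra.
Qed.

Lemma regretE n : regret mu astar Pr a n =
  \sum_(1 <= t < n.+1) \sum_i (mu i - mu astar) * nu t 0 i.
Proof.
rewrite /regret exchange_big/=; apply: eq_bigr => i _; rewrite mulr_sumr.
by apply: eq_bigr => t _; rewrite mxE.
Qed.

Lemma regret_ge0 n : 0 <= regret mu astar Pr a n.
Proof.
rewrite regretE; apply: sumr_ge0 => t _; apply: sumr_ge0 => i _.
by rewrite mulr_ge0 ?gap0 ?marginal_ge0.
Qed.

Lemma max_step_gt0 : 0 < L.
Proof.
have [b ab] := adj_exists astar.
have ba : b != astar by apply: contraTneq ab => ->; rewrite adj_irr.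
apply: lt_le_trans (step_le_max _ _ ab).
by rewrite normr_gt0 subr_eq0 gt_eqF ?astar_min.
Qed.

Hypothesis contraction_lt_gamma : N%:R * L < gamma.

Lemma contraction_exponent : 0 < q < 1.
Proof.
have [N0 _] := contraction_timeP.
rewrite ltr_pdivrMr// mul1r contraction_lt_gamma andbT.
by rewrite divr_gt0// mulr_gt0 ?max_step_gt0 ?ltr0n.
Qed.

Lemma regret_le_excess_mass : exists C : R, forall n,
  regret mu astar Pr a n <=
    2 * Delta / deg astar * \sum_(1 <= t < n.+1) excess_mass t + C.
Proof.
have [c c0 relax] := energy_relaxation.
have [C HC] := relaxation_sum _ _ _ _ _ contraction_exponent c0 energy_ge0
  excess_mass_ge0 relax.
have K0 : 0 <= Delta / deg astar.
  by rewrite divr_ge0 ?(ltW max_gap_gt0) ?(ltW (deg_gt0 _)).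
exists (Delta / deg astar * C) => n; rewrite regretE.
apply: (@le_trans _ _ (\sum_(1 <= t < n.+1) Delta / deg astar * energy t)).
  by apply: ler_sum => t _; exact: expected_cost_le.
rewrite -mulr_sumr; have := ler_wpM2l K0 (HC n); lra.
Qed.

Local Notation s i := ((mu i - mu astar) / gamma).

(** The relaxation bound gives half of each coefficient, up to lower-order terms.
    A neighbour [b] of [astar] has exponent [1 - s b] in the open unit interval,
    and the unused half of its term dominates every term of order at most
    [n ^ p'] for an exponent [p'] strictly below [1 - s b]. *)
Lemma regret_eventually_le : exists m0 : nat, forall n, (m0 <= n)%N ->
  regret mu astar Pr a n <=
    \sum_(i < k | i != astar) 4 * Delta * deg i / (deg astar * (1 - s i))
       * (n%:R + 1) `^ (1 - s i).
Proof.
have [b ab] := adj_exists astar.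
have ba : b != astar by apply: contraTneq ab => ->; rewrite adj_irr.
have [N0 _] := contraction_timeP.
have sb1 : s b < 1.
  rewrite ltr_pdivrMr// mul1r; apply: le_lt_trans contraction_lt_gamma.
  apply: (le_trans (ler_norm _)); apply: (le_trans (step_le_max _ _ ab)).
  by rewrite ler_peMl ?max_step_ge0// ler1n.
have s0 i : i != astar -> 0 < s i.
  by move=> ia; rewrite divr_gt0// subr_gt0 astar_min.
have sb0 := s0 b ba.
pose p' := (1 - s b) / 2.
have p'0 : 0 < p' by rewrite /p'; lra.
have p'1 : p' < 1 by rewrite /p'; lra.
pose c i := 2 * Delta * deg i / deg astar.
have c0 i : 0 < c i.
  by rewrite divr_gt0 ?deg_gt0// !mulr_gt0 ?deg_gt0 ?max_gap_gt0.
(* If s i >= 1 the power sum is compared with the exponent 1 - p' < 1, and the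
   announced term, of nonpositive coefficient, is bounded. *)
have term i : exists B, 0 <= B /\ (i != astar -> forall n : nat,
    c i * \sum_(1 <= t < n.+1) (t%:R + 1) `^ (- s i) <=
      2 * c i / (1 - s i) * (n%:R + 1) `^ (1 - s i) + B * (n%:R + 1) `^ p').
  have := ltW (c0 i).
  case: (ltP (s i) 1) => si ci.
    exists 0; split=> // ia n; rewrite mul0r addr0.
    have := @sum_powRN_le R (s i) n; rewrite si s0// => /(_ isT) H.
    have := ler_wpM2l ci H; set X := _ `^ _ => H'.
    have : 0 <= c i * (X / (1 - s i)).
      by rewrite mulr_ge0// divr_ge0 ?powR_ge0//; lra.
    have -> : 2 * c i / (1 - s i) * X = 2 * (c i * (X / (1 - s i))) by ring.
    lra.
  exists (c i / p' + `|2 * c i / (1 - s i)|); split.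
    by rewrite addr_ge0// divr_ge0// ltW.
  move=> ia n.
  have := @sum_powRN_le R (1 - p') n.
  have -> : 1 - (1 - p') = p' by ring.
  have -> : 0 < 1 - p' < 1 by apply/andP; split; lra.
  move=> /(_ isT) H.
  have {}H : \sum_(1 <= t < n.+1) (t%:R + 1) `^ (- s i) <=
      (n%:R + 1) `^ p' / p' :> R.
    apply: le_trans H; apply: ler_sum => t _.
    by rewrite ler_powR ?time_ge1// lerN2; lra.
  have {}H := ler_wpM2l ci H.
  have X1 : (n%:R + 1) `^ (1 - s i) <= 1 :> R.
    by rewrite -opprB powRN_le1 ?time_ge1// subr_ge0.
  have X0 : 0 <= (n%:R + 1) `^ (1 - s i) :> R by exact: powR_ge0.
  have Y1 : 1 <= (n%:R + 1) `^ p' :> R.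
    by rewrite -[leLHS](powRr0 (n%:R + 1)) ler_powR ?time_ge1 ?ltW.
  have := ler_norm (- (2 * c i / (1 - s i))); rewrite normrN => Z.
  have Z0 := normr_ge0 (2 * c i / (1 - s i)).
  set X := _ `^ (1 - _) in X1 X0 *; set Y := _ `^ p' in H Y1 *.
  set z := 2 * c i / _ in Z Z0 *.
  have -> : (c i / p' + `|z|) * Y = c i * (Y / p') + `|z| * Y by ring.
  have : - (z * X) <= `|z| * Y.
    rewrite -mulNr; apply: (@le_trans _ _ (`|z| * X)); first exact: ler_wpM2r.
    by rewrite ler_wpM2l//; lra.
  lra.
have [B HB] := choice term.
have [C HC] := regret_le_excess_mass.
pose Bs := \sum_(i < k | i != astar) B i.
have Bs0 : 0 <= Bs by apply: sumr_ge0 => i _; exact: (HB i).1.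
have [M HM] := @powR_dominates R (1 - s b) p' `|C| Bs (c b / (1 - s b))
   ltac:(rewrite /p'; lra) ltac:(by rewrite divr_gt0 ?c0// subr_gt0)
   (normr_ge0 _) Bs0.
exists M => n Mn; apply: (le_trans (HC n)).
have -> : 2 * Delta / deg astar * \sum_(1 <= t < n.+1) excess_mass t =
    \sum_(i < k | i != astar) c i * \sum_(1 <= t < n.+1) (t%:R + 1) `^ (- s i).
  under eq_bigr do rewrite excess_massE.
  rewrite exchange_big/= mulr_sumr; apply: eq_bigr => i _.
  by rewrite /c /gibbs -mulr_sumr; ring.
have coefE i : 4 * Delta * deg i / (deg astar * (1 - s i)) = 2 * c i / (1 - s i).
  by rewrite invfM /c; ring.
under [leRHS]eq_bigr do rewrite coefE.
rewrite (bigD1 b)//= [leRHS](bigD1 b)//=.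
have H1 : \sum_(i < k | (i != astar) && (i != b))
      c i * \sum_(1 <= t < n.+1) (t%:R + 1) `^ (- s i) <=
    \sum_(i < k | (i != astar) && (i != b))
      2 * c i / (1 - s i) * (n%:R + 1) `^ (1 - s i) + Bs * (n%:R + 1) `^ p'.
  apply: (@le_trans _ _ (\sum_(i < k | (i != astar) && (i != b))
      (2 * c i / (1 - s i) * (n%:R + 1) `^ (1 - s i) + B i * (n%:R + 1) `^ p'))).
    by apply: ler_sum => i /andP[ia _]; exact: (HB i).2.
  rewrite big_split/= lerD2l -mulr_suml ler_wpM2r ?powR_ge0//.
  by rewrite /Bs [leRHS](bigD1 b)//= ler_wpDl// (HB b).1.
have := @sum_powRN_le R (s b) n; rewrite sb0 sb1 => /(_ isT) H2.
have := ler_wpM2l (ltW (c0 b)) H2.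
have := HM n Mn; have := ler_norm C.
set X := _ `^ (1 - s b); set Y := _ `^ p' in H1 *.
have -> : c b * (X / (1 - s b)) = c b / (1 - s b) * X by ring.
have -> : 2 * c b / (1 - s b) * X = 2 * (c b / (1 - s b) * X) by ring.
lra.
Qed.

(** For exponents [p] between 0 and 1, [(n + 1) ^ p <= (2 n) ^ p <= 2 n ^ p];
    the terms with negative exponents have negative coefficients. *)
Lemma regret_bigO :
  (fun n : nat => regret mu astar Pr a n) =O_\oo
  (fun n : nat => \sum_(i < k | i != astar) n%:R `^ (1 - s i)).
Proof.
have [m0 H] := regret_eventually_le.
pose C i := 4 * Delta * deg i / (deg astar * (1 - s i)).
pose K := 1 + \sum_(i < k | i != astar) 2 * `|C i|.
have S0 : 0 <= \sum_(i < k | i != astar) 2 * `|C i|.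
  by apply: sumr_ge0 => i _; rewrite mulr_ge0.
apply/eqO_exP; exists K; first by rewrite /K; lra.
exists (maxn m0 1) => // n /=; rewrite geq_max => /andP[mn n1].
rewrite (ger0_norm (regret_ge0 n)) ger0_norm; last first.
  by apply: sumr_ge0 => i _; exact: powR_ge0.
apply: (le_trans (H n mn)); rewrite -/(C _).
have n1' : 1 <= n%:R :> R by rewrite ler1n.
rewrite mulr_sumr; apply: ler_sum => i ia.
rewrite -/(C i).
have CK : 2 * `|C i| <= K.
  rewrite /K (bigD1 i)//=.
  have : 0 <= \sum_(j < k | (j != astar) && (j != i)) 2 * `|C j|.
    by apply: sumr_ge0 => j _; rewrite mulr_ge0.
  lra.
apply: le_trans (ler_wpM2r (powR_ge0 _ _) CK).
case: (lerP (s i) 1) => si.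
  apply: (@le_trans _ _ (`|C i| * (n%:R + 1) `^ (1 - s i))).
    by rewrite ler_wpM2r ?powR_ge0 ?ler_norm.
  rewrite -mulrA mulrCA ler_wpM2l//.
  apply: (@le_trans _ _ ((2 * n%:R) `^ (1 - s i))).
    by apply: ge0_ler_powR; rewrite ?nnegrE ?subr_ge0//; lra.
  rewrite powRM// ler_wpM2r ?powR_ge0//.
  by apply: ler1_powR; [lra|rewrite gerBl gap_ge0].
apply: (@le_trans _ _ 0); last by rewrite !mulr_ge0 ?powR_ge0.
rewrite mulr_le0_ge0 ?powR_ge0// /C.
rewrite mulr_ge0_le0 ?mulr_ge0 ?(ltW (deg_gt0 _)) ?(ltW max_gap_gt0)//.
by rewrite invr_le0 pmulr_rle0 ?deg_gt0// subr_le0 ltW.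
Qed.

End Annealing.

(** * The regret bound *)

Theorem theorem2 (R : realType) (k : nat) (hk : (2 <= k)%N)
  (mu : 'I_k -> R) (astar : 'I_k)
  (hmin : forall i : 'I_k, i != astar -> mu astar < mu i)
  (adj : rel 'I_k) (hsym : symmetric adj) (hirr : irreflexive adj)
  (hconn : forall i j : 'I_k, connect adj i j)
  (g : 'I_k -> 'I_k -> R) (hg : forall i j : 'I_k, adj i j -> g i j = 1)
  (gamma : R)
  (d : measure_display) (Omega : measurableType d) (Pr : probability Omega R)
  (a : nat -> Omega -> 'I_k)
  (hchain :
    markov_chain (annealing_matrix adj mu g (log_cooling gamma)) Pr a) :
  let N : nat :=
    contraction_time (annealing_matrix adj mu g (log_cooling gamma)) in
  let tau : R := N%:R in
  let L := max_step adj mu in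
  let rho := min_ratio adj g ^+ N in
  let Delta := max_gap mu astar in
  let q := tau * L / gamma in
  tau * L < gamma ->
  critical_depth adj mu astar <= tau * L ->
  (exists m0 : nat, forall n : nat, (m0 <= n)%N ->
     regret mu astar Pr a n <=
       2 * Delta
         * expR (rho / (tau `^ q * (1 - q)) * (m0%:R / tau + 1) `^ (1 - q))
         / (rho / (tau * (1 - q))) ^ Num.floor (1 - q)^-1
         * Gamma (1 + (Num.ceil (1 - q)^-1)%:~R)
       + \sum_(i < k | i != astar)
           4 * Delta * node_weight adj g i
             / (node_weight adj g astar * (1 - (mu i - mu astar) / gamma))
           * (n%:R + 1) `^ (1 - (mu i - mu astar) / gamma))
  /\ (fun n : nat => regret mu astar Pr a n) =O_\oo
     (fun n : nat =>
        \sum_(i < k | i != astar) n%:R `^ (1 - (mu i - mu astar) / gamma)).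
Proof.
move=> N tau L rho Delta q ltg _.
have L0 : 0 <= tau * L by rewrite mulr_ge0 ?max_step_ge0.
have g0 : 0 < gamma by exact: le_lt_trans ltg.
split; last first.
  exact: (regret_bigO mu astar adj g gamma hk hmin hsym hirr hconn hg g0
    Pr a hchain ltg).
have [m0 H] := regret_eventually_le mu astar adj g gamma hk hmin hsym hirr
  hconn hg g0 Pr a hchain ltg.
exists m0 => n mn; apply: (le_trans (H n mn)); rewrite lerDr.
have q1 : 0 <= 1 - q.
  by rewrite subr_ge0 ler_pdivrMr// mul1r ltW.
have D0 : 0 <= Delta by exact: bigmax_ge_id.
have rho0 : 0 <= rho.
  rewrite exprn_ge0//; apply: (big_ind (fun x => 0 <= x)) => // [x y x0 y0|i _].
    by rewrite le_min x0.
  apply: (big_ind (fun x => 0 <= x)) => // [x y x0 y0|j ij]; first by rewrite le_min x0.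
  rewrite hg// div1r invr_ge0 ltW//.
  by apply: (deg_gt0 adj g).
rewrite mulr_ge0//; last first.
  by apply: Rintegral_ge0 => t _; rewrite mulr_ge0 ?powR_ge0 ?expR_ge0.
rewrite divr_ge0 ?exprz_ge0 ?divr_ge0 ?mulr_ge0 ?expR_ge0//.
Qed.
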